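(* Let $p>4$ be a prime, and let $d$ be any integer with $\left(\frac{d}{p}\right)=1$. Then $$\left(\frac{S_{p-4}(d,p)}{p}\right)=-1\iff p\equiv 3 \text{ or } 7\pmod{20}.$$
   Context: $\left(\frac{\cdot}{p}\right)$ denotes the Legendre symbol (with value $0$ on multiples of $p$). For an odd prime $p$, an integer $d$ and a positive integer $m$, $S_m(d,p)$ denotes the integer $$S_m(d,p)=\det\left[(i^2+dj^2)^m\right]_{1\leqslant i,j\leqslant (p-1)/2}.$$ *)

(* Defs.v *)
From mathcomp Require Import all_boot all_order all_algebra.
Set Implicit Arguments.
Unset Strict Implicit.
Unset Printing Implicit Defensive.
Import GRing.Theory Num.Theory.
Local Open Scope ring_scope.

(* Meaningful when p is an odd prime. *)
Definition legendre (a : int) (p : nat) : int :=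
  if (p%:Z %| a)%Z then 0
  else if [exists x : 'I_p, ((x%:Z ^+ 2)%R == a %[mod p%:Z])%Z] then 1
  else -1.

(* Ordinals start at 0, so i.+1 and j.+1 range over 1, ..., (p - 1) / 2. *)
Definition Smx (m : nat) (d : int) (p : nat) : 'M[int]_((p.-1)./2) :=
  \matrix_(i, j) (i.+1%:Z ^+ 2 + d * j.+1%:Z ^+ 2) ^+ m.

Definition Sdet (m : nat) (d : int) (p : nat) : int := \det (Smx m d p).

(* Main.v *)
Require Import Defs.
From mathcomp Require Import all_boot all_order all_algebra.
From mathcomp Require Import cyclic finfield ring zify.
Import GRing.Theory Num.Theory.
Local Open Scope ring_scope.

(** Write [p = 2n + 1], let [S] be the determinant, and work in the field with
    [p] elements, where being a non-residue means not being a square.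

    Since [p - 4] is [-4] modulo [p], the binomial series for [(1 - y)^(-4)]
    suggests, and [sub1_expr_sum] proves,
    [6 (1 - y)^(p-4) = sum_(k < p-1) (k+1)(k+2)(k+3) y^k].  For
    [y = - d j^2 / i^2] one has [y^n = (-1)^n], so the terms [k] and [k + n] can
    be merged, and [(1 - y)^(p-4)] becomes a polynomial in [y] with only [n]
    terms ([sub1_expr_folded]).  Because [2n = -1], the merged coefficients are
    simple: with [v = 4s + 7] the coefficient of [y^s] is, up to a constant
    factor, [v^2 - 5] when [n] is odd and [v (v^2 - 13)] when [n] is even.

    As [y] is a product of a factor depending on [i] and one depending on [j],
    the matrix is a product of two Vandermonde matrices around a diagonal one
    ([det_sum_pow]).  The two Vandermonde determinants differ by a nonzero
    square, and so [S] is a nonzero square times the product of the merged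
    coefficients ([Sdet_Fp]).

    In that product [s] and [n - 3 - s] give opposite values of [v], hence equal
    factors up to sign.  What is left over is the pair [v = -3], [v = 1], and
    for odd [n] the midpoint [v = 0], whose factor is [-5].
    - If [p = 1] modulo 4, then [S] is a square up to sign, and [-1] is a
      square, so [S] is a square.
    - If [p = 3] modulo 4, [S] is [5] times a square, and that square can vanish
      only if some [v^2 - 5] does, that is only if [5] is itself a square.  So
      [S] is a non-residue exactly when [5] is, and a Gauss sum over the fifth
      roots of unity ([expr5_half_Fp]) shows that this means [p = 2] or [3]
      modulo 5. *)

(** * Squares modulo a prime *)

Lemma intr_Fp_eq0 (p : nat) (p_prime : prime p) (a : int) :
  (a%:~R == 0 :> 'F_p) = (p%:Z %| a)%Z.
Proof.
have chF := pchar_Fp p_prime.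
case: a => n; rewrite ?NegzE ?mulrNz ?oppr_eq0 -pmulrn -(dvdn_pcharf chF);
  by rewrite dvdzE ?abszN !absz_nat.
Qed.

Lemma exists_sqr_modP (p : nat) (p_prime : prime p) (a : int) :
  reflect (exists y : 'F_p, a%:~R = y ^+ 2)
    [exists x : 'I_p, ((x%:Z ^+ 2)%R == a %[mod p%:Z])%Z].
Proof.
have E (x : nat) :
    ((x%:Z ^+ 2)%R == a %[mod p%:Z])%Z = (a%:~R == x%:R ^+ 2 :> 'F_p).
  rewrite eqz_mod_dvd -intr_Fp_eq0 // rmorphB rmorphXn /= -pmulrn.
  by rewrite subr_eq0 eq_sym.
apply: (iffP existsP) => [[x]|[y hy]].
  by rewrite E => /eqP h; exists x%:R.
have ly : (y < p)%N by rewrite -[X in (_ < X)%N](Fp_cast p_prime).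
by exists (Ordinal ly); rewrite E /= natr_Zp hy.
Qed.

(** Multiples of [p] fit in because zero is a square. *)
Lemma legendre_eqN1 (p : nat) (p_prime : prime p) (a : int) :
  legendre a p = -1 <-> ~ exists y : 'F_p, a%:~R = y ^+ 2.
Proof.
rewrite /legendre -intr_Fp_eq0 //.
case: eqP => [-> | _].
  by split=> // []; case; exists 0; rewrite expr0n.
by case: exists_sqr_modP => // h; split.
Qed.

Lemma legendre_eq1 (p : nat) (p_prime : prime p) (a : int) :
  legendre a p = 1 -> exists2 y : 'F_p, y != 0 & a%:~R = y ^+ 2.
Proof.
rewrite /legendre; case: ifP => // /negbT; rewrite -intr_Fp_eq0 // => a0.
case: exists_sqr_modP => // [[y ay]] _; exists y => //.
by move: a0; rewrite ay expf_eq0.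
Qed.

Lemma finField_prim_root (F : finFieldType) (k : nat) :
  (k %| #|F|.-1)%N -> exists z : F, k.-primitive_root z.
Proof.
have F1 : (0 < #|F|.-1)%N by rewrite -subn1 subn_gt0 finNzRing_gt1.
have /hasP [z _ pz] :
    has (#|F|.-1).-primitive_root (enum [pred x : F | x != 0]).
  apply: has_prim_root => //; last by rewrite -cardE cardC1.
  - apply/allP => x; rewrite mem_enum inE => x0; apply/unity_rootP.
    apply: (mulfI x0); rewrite -exprS prednK ?expf_card ?mulr1 //.
    exact: ltnW (finNzRing_gt1 F).
  - exact: enum_uniq.
move=> dk; exists (z ^+ (#|F|.-1 %/ k)); exact: dvdn_prim_root.
Qed.

Lemma sqr_opp1_Fp (p : nat) (p_prime : prime p) :
  (p = 1 %[mod 4])%N -> exists i : 'F_p, i ^+ 2 = -1.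
Proof.
move=> p1; have [|z pz] := finField_prim_root 'F_p 4.
  rewrite card_Fp //; have := prime_gt1 p_prime; lia.
exists z; have z41 := prim_expr_order pz.
have : (z ^+ 2 - 1) * (z ^+ 2 + 1) = 0.
  by transitivity (z ^+ 4 - 1); [ring | rewrite z41 subrr].
move/eqP; rewrite mulf_eq0 => /orP []; last by rewrite addr_eq0 => /eqP.
rewrite subr_eq0 -(expr0 z) => /eqP /esym /eqP.
by rewrite (eq_prim_root_expr pz).
Qed.

(** Quadratic reciprocity for [5] by a Gauss sum.  In the field with [p^4]
    elements there is a primitive fifth root of unity [z], and
    [tau = z - z^2 - z^3 + z^4] squares to [5].  The Frobenius map sends [z] to
    [z^p], which only depends on [p] modulo 5, and so [tau] to [tau] or
    [- tau]; comparing with [tau^p = 5^((p-1)/2) tau] gives the value. *)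
Lemma expr5_half_Fp (p : nat) (p_prime : prime p) (p_gt5 : (5 < p)%N) :
  5 ^+ (p./2) = (if (p %% 5 == 1)%N || (p %% 5 == 4)%N then 1 else -1) :> 'F_p.
Proof.
have [L chL cardL] := pPrimePowerField p_prime (isT : (0 < 4)%N).
have cop : coprime 5 p.
  by rewrite coprime_sym prime_coprime // gtnNdvd.
have p5_gt0 : (p %% 5 != 0)%N.
  by rewrite -/(5 %| p)%N -prime_coprime.
have lt5 : (p %% 5 < 5)%N by rewrite ltn_mod.
have odd_p : odd p by case: (even_prime p_prime) p_gt5 => [-> |].
(* The order of the multiplicative group of a field with p^4 elements is a
   multiple of 5, by Fermat. *)
have [|z pz] := finField_prim_root L 5.
  rewrite cardL -subn1 -eqn_mod_dvd ?expn_gt0 ?prime_gt0 // -modnXm.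
  by move: lt5 p5_gt0; case: (p %% 5)%N => [|[|[|[|[|r]]]]].
have z5 := prim_expr_order pz.
have z1 : z - 1 != 0.
  by rewrite subr_eq0 -(expr0 z) -{1}(expr1 z) (eq_prim_root_expr pz).
have cyc : 1 + z + z ^+ 2 + z ^+ 3 + z ^+ 4 = 0.
  apply: (mulfI z1); rewrite mulr0.
  by transitivity (z ^+ 5 - 1); [ring | rewrite z5 subrr].
pose tau := z - z ^+ 2 - z ^+ 3 + z ^+ 4.
have tau2 : tau ^+ 2 = 5.
  (* Explicit division by the polynomials [z^5 - 1] and [1 + z + .. + z^4]. *)
  transitivity ((z ^+ 5 - 1) * (z ^+ 3 - z ^+ 2 *+ 2 - z + 4) + 5
                - (1 + z + z ^+ 2 + z ^+ 3 + z ^+ 4)).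
    by rewrite /tau; ring.
  by rewrite z5 cyc subrr mul0r add0r subr0.
have tau0 : tau != 0.
  have : tau ^+ 2 != 0 by rewrite tau2 -(dvdn_pcharf chL) gtnNdvd.
  by rewrite expf_eq0.
have tau_p : tau ^+ p =
    (if (p %% 5 == 1)%N || (p %% 5 == 4)%N then 1 else -1) * tau.
  rewrite /tau -(pFrobenius_autE chL) !(rmorphD, rmorphN, rmorphXn) /=.
  rewrite (pFrobenius_autE chL) -(prim_expr_mod pz p).
  have mod5 k : z ^+ (5 + k) = z ^+ k by rewrite exprD z5 mul1r.
  move: lt5 p5_gt0; case: (p %% 5)%N => [|[|[|[|[|r]]]]] //= _ _.
  - by rewrite expr1 mul1r.
  - rewrite -!exprM (mod5 1) (mod5 3); ring.
  - rewrite -!exprM (mod5 1) (mod5 4) (mod5 (5 + 2)%N) (mod5 2); ring.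
  - rewrite -!exprM (mod5 3) (mod5 (5 + 2)%N) (mod5 2).
    by rewrite (mod5 (5 + (5 + 1))%N) (mod5 (5 + 1)%N) (mod5 1%N); ring.
have half : 5 ^+ p./2 =
    (if (p %% 5 == 1)%N || (p %% 5 == 4)%N then 1 else -1) :> L.
  apply: (mulIf tau0); rewrite -tau_p -tau2 -exprM -exprSr; congr (_ ^+ _).
  by rewrite mul2n -[RHS]odd_double_half odd_p.
(* Both sides come from integers, so the equality passes from [L] to ['F_p]. *)
move: half; case: ifP => _ /eqP; rewrite -natrX.
  rewrite -[1]/(1%:R) -subr_eq0 -natrB ?expn_gt0 // -(dvdn_pcharf chL).
  rewrite (dvdn_pcharf (pchar_Fp p_prime)) natrB ?expn_gt0 // subr_eq0.
  by rewrite natrX => /eqP.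
rewrite -addr_eq0 natr1 -(dvdn_pcharf chL).
by rewrite (dvdn_pcharf (pchar_Fp p_prime)) -natr1 addr_eq0 natrX => /eqP.
Qed.

Lemma expf_pred_p (p : nat) (p_prime : prime p) (x : 'F_p) :
  x != 0 -> x ^+ p.-1 = 1.
Proof.
move=> x0; apply: (mulfI x0); rewrite -exprS prednK ?prime_gt0 // mulr1.
by have := expf_card x; rewrite card_Fp.
Qed.

(** When [p = 3] modulo 4, Euler's criterion is explicit: if
    [5^((p-1)/2) = 1], then [5 = 5^((p+1)/2)] and the exponent
    [(p+1)/2] is even. *)
Lemma sqr_5_Fp (p : nat) (p_prime : prime p) (p_gt5 : (5 < p)%N) :
  (p = 3 %[mod 4])%N ->
  (exists y : 'F_p, 5 = y ^+ 2) <-> (p %% 5 == 1)%N || (p %% 5 == 4)%N.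
Proof.
move=> p3; have := expr5_half_Fp _ p_prime p_gt5.
have two0 : 2 != 0 :> 'F_p.
  by rewrite -(dvdn_pcharf (pchar_Fp p_prime)) gtnNdvd //; lia.
case: ifP => _ half; split=> //.
  move=> _; exists (5 ^+ (p./2).+1./2); rewrite -exprM.
  rewrite (_ : (_ * 2)%N = (p./2).+1); last by lia.
  by rewrite exprS half mulr1.
case=> y y2; have y0 : y != 0.
  apply: contra_eq_neq y2 => ->; rewrite expr0n.
  by rewrite -(dvdn_pcharf (pchar_Fp p_prime)) gtnNdvd.
have := expf_pred_p _ p_prime _ y0.
rewrite (_ : p.-1 = (2 * p./2)%N); last by lia.
rewrite exprM -y2 half => /eqP; rewrite eq_sym -addr_eq0 => /eqP h.
by rewrite -[2]/(1 + 1) h eqxx in two0.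
Qed.

(** * The power [p - 4] as a short polynomial *)

(** Modulo [p] this is the binomial coefficient of [-4].  For [k] in
    [p-3 .. p-1] both sides vanish, which allows the sum in [sub1_expr_sum] to
    run over a multiple of [(p-1)/2] terms. *)
Lemma binom_neg4 (F : fieldType) (p : nat) (chF : p \in [pchar F])
    (p_gt4 : (4 < p)%N) (k : nat) :
  (k < p)%N ->
  6 * (-1) ^+ k * 'C(p - 4, k)%:R = (k.+1 * k.+2 * k.+3)%:R :> F.
Proof.
elim: k => [|k IHk] lt_k; first by rewrite bin0 expr0 !mulr1.
have k1 : k.+1%:R != 0 :> F by rewrite -(dvdn_pcharf chF) gtnNdvd.
apply: (mulfI k1).
have step : k.+1%:R * 'C(p - 4, k.+1)%:R
    = - (k%:R + 4) * 'C(p - 4, k)%:R :> F.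
  rewrite -natrM mul_bin_left natrM.
  have [lt_pk | le_kp] := ltnP (p - 4) k; first by rewrite bin_small // !mulr0.
  rewrite natrB // natrB 1?ltnW // (pcharf0 chF); ring.
rewrite exprS.
transitivity (6 * (-1) ^+ k * - (k.+1%:R * 'C(p - 4, k.+1)%:R) : F); first ring.
rewrite step.
transitivity ((k%:R + 4) * (6 * (-1) ^+ k * 'C(p - 4, k)%:R) : F); first ring.
by rewrite IHk 1?ltnW // -[4]/(4%:R) -natrD -!natrM; congr (_%:R); lia.
Qed.

Lemma sub1_expr_sum (F : fieldType) (p : nat) (chF : p \in [pchar F])
    (p_gt4 : (4 < p)%N) (y : F) :
  6 * (1 - y) ^+ (p - 4) =
    \sum_(k < p.-1) (k.+1 * k.+2 * k.+3)%:R * y ^+ k.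
Proof.
rewrite exprDn (big_ord_widen p.-1
  (fun k => 1 ^+ (p - 4 - k) * (- y) ^+ k *+ 'C(p - 4, k))); last by lia.
rewrite big_mkcond mulr_sumr; apply: eq_bigr => k _.
have lt_k : (k < p)%N by have := ltn_ord k; lia.
rewrite -(binom_neg4 _ _ chF) // (exprNn y) expr1n -mulr_natr.
case: ltnP => [_|le]; first ring.
by rewrite bin_small // !(mulr0, mul0r).
Qed.

(** With [v = 4s + 7], this is a constant multiple of
    [(s+1)(s+2)(s+3) + (-1)^n (s+n+1)(s+n+2)(s+n+3)] when [2n = -1]: centring at
    [v] turns this cubic into an even or odd polynomial, on which the pairing
    of the factors below relies. *)
Definition folded_coef {F : fieldType} (n : nat) (v : F) : F :=
  if odd n then v ^+ 2 - 5 else v * (v ^+ 2 - 13).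

(** The constant between [(1 - y)^(p-4)] and the polynomial with coefficients
    [folded_coef]. *)
Definition folded_scale (n : nat) : nat := if odd n then 64%N else 192%N.

(** The relation [y^n = (-1)^n] merges the terms [k] and [k + n] of the
    truncated binomial series. *)
Lemma sub1_expr_folded (F : fieldType) (n : nat)
    (chF : n.*2.+1 \in [pchar F]) (n_gt1 : (1 < n)%N) (y : F) :
  y ^+ n = (-1) ^+ n ->
  (folded_scale n)%:R * (1 - y) ^+ (n.*2.+1 - 4) =
    \sum_(s < n) folded_coef n (4 * s%:R + 7) * y ^+ s.
Proof.
move=> yn; have n2 : n%:R *+ 2 = - 1 :> F.
  by apply/eqP; rewrite -addr_eq0 -mulrnA muln2 natr1 (pcharf0 chF).
have n3 : 3 != 0 :> F by rewrite -(dvdn_pcharf chF) gtnNdvd //; lia.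
have fold : 6 * (1 - y) ^+ (n.*2.+1 - 4) =
    \sum_(s < n) ((s%:R + 1) * (s%:R + 2) * (s%:R + 3) + (-1) ^+ n *
      (((n + s)%:R + 1) * ((n + s)%:R + 2) * ((n + s)%:R + 3))) * y ^+ s.
  rewrite (sub1_expr_sum _ _ chF) /=; last by lia.
  rewrite -addnn big_split_ord /= -big_split /=.
  have nat3 k : (k.+1 * k.+2 * k.+3)%:R =
      (k%:R + 1) * (k%:R + 2) * (k%:R + 3) :> F.
    by rewrite -[k.+3]addn3 -[k.+2]addn2 -[k.+1]addn1 !natrM !natrD.
  by apply: eq_bigr => s _; rewrite exprD yn !nat3; ring.
apply: (mulfI n3).
have -> : 3 * ((folded_scale n)%:R * (1 - y) ^+ (n.*2.+1 - 4)) =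
    (if odd n then 32 else 96) * (6 * (1 - y) ^+ (n.*2.+1 - 4)).
  by rewrite /folded_scale; case: ifP => _; ring.
rewrite fold !mulr_sumr; apply: eq_bigr => s _.
have two0 : 2 != 0 :> F by rewrite -(dvdn_pcharf chF) gtnNdvd //; lia.
have -> : (n + s)%:R = s%:R - 2^-1 :> F.
  by apply: (mulIf two0); rewrite natrD mulrDl mulr_natr n2; field.
by rewrite /folded_coef -signr_odd; case: (odd n); field.
Qed.

(** * The determinant up to squares *)

(** The matrix is [V(u)^T *m diag(c) *m V(w)], with [V] the Vandermonde matrix
    of its nodes. *)
Lemma det_sum_pow (R : comPzRingType) (n : nat) (c : 'I_n -> R)
    (u w : 'rV[R]_n) :
  \det (\matrix_(i, j) \sum_(s < n) c s * (u 0 i * w 0 j) ^+ s) =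
    (\prod_s c s) * \det (Vandermonde n u) * \det (Vandermonde n w).
Proof.
have -> : \matrix_(i, j) (\sum_(s < n) c s * (u 0 i * w 0 j) ^+ s) =
    (Vandermonde n u)^T *m diag_mx (\row_s c s) *m Vandermonde n w.
  apply/matrixP => i j; rewrite -mulmxA mul_diag_mx !mxE; apply: eq_bigr => s _.
  by rewrite !mxE exprMn; ring.
rewrite !det_mulmx det_tr det_diag [_ * \prod_i _]mulrC.
by congr (_ * _ * _); apply: eq_bigr => s _; rewrite mxE.
Qed.

(** For odd [n] the constant itself is a square, for even [n] the exponent is
    even. *)
Lemma folded_scale_sqr (F : fieldType) (p : nat) (chF : p \in [pchar F])
    (p_gt4 : (4 < p)%N) (n : nat) :
  exists2 K : F, K != 0 & (folded_scale n)%:R ^+ n = K ^+ 2.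
Proof.
have small_neq0 k : (0 < k < 5)%N -> k%:R != 0 :> F.
  by move=> hk; rewrite -(dvdn_pcharf chF) gtnNdvd //; lia.
have K0 a b c : (2 ^ a * 3 ^ b)%:R ^+ c != 0 :> F.
  by rewrite natrM !natrX !(expf_neq0, mulf_neq0, small_neq0).
rewrite /folded_scale; case: ifP => odd_n.
  exists ((2 ^ 3 * 3 ^ 0)%:R ^+ n); first exact: K0.
  by rewrite exprAC; congr (_ ^+ n); rewrite -natrX.
exists ((2 ^ 6 * 3 ^ 1)%:R ^+ n./2); first exact: K0.
by rewrite -exprM muln2; congr (_ ^+ _); lia.
Qed.

(** Dividing row [i] by the square [(i^2)^(p-4)] leaves the powers of
    [1 - u_i w_j], with [u_i = i^-2] and [w_j = - d j^2]; these factor through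
    the Vandermonde matrices of [u] and [w], which are invertible since the
    squares [i^2] for [1 <= i <= (p-1)/2] are distinct modulo [p]. *)
Lemma Sdet_Fp (p : nat) (p_prime : prime p) (p_gt4 : (4 < p)%N)
    (n := (p.-1)./2) (d : int) (del : 'F_p) :
  del != 0 -> d%:~R = del ^+ 2 ->
  exists2 g : 'F_p, g != 0 &
    (Sdet (p - 4) d p)%:~R =
      g ^+ 2 * \prod_(s < n) folded_coef n (4 * s%:R + 7).
Proof.
move=> del0 d_sqr; have chF := pchar_Fp p_prime.
have odd_p : odd p by case: (even_prime p_prime) p_gt4 => [-> |].
have pn : n.*2.+1 = p.
  by rewrite /n; lia.
have n_gt1 : (1 < n)%N by move: p_gt4; rewrite -pn; lia.
have small_neq0 k : (0 < k)%N -> (k < p)%N -> k%:R != 0 :> 'F_p.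
  by move=> k0 kp; rewrite -(dvdn_pcharf chF) gtnNdvd.
have [z zE z0] : exists2 z : 'I_n -> 'F_p,
    forall i : 'I_n, i.+1%:R = z i & forall i, z i != 0.
  exists (fun i : 'I_n => i.+1%:R) => // i; apply: small_neq0 => //.
  by have := ltn_ord i; lia.
pose u : 'rV['F_p]_n := \row_i (z i ^+ 2)^-1.
pose w : 'rV['F_p]_n := \row_j - (del * z j) ^+ 2.
pose A := \matrix_(i, j) \sum_(s < n)
  folded_coef n (4 * s%:R + 7) * (u 0 i * w 0 j) ^+ s.
have scaled : (folded_scale n)%:R *: map_mx intr (Smx (p - 4) d p) =
    diag_mx (\row_i (z i ^+ (p - 4)) ^+ 2) *m A.
  apply/matrixP => i j; rewrite mul_diag_mx !mxE.
  rewrite rmorphXn rmorphD rmorphM !rmorphXn /= d_sqr -!pmulrn !zE.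
  rewrite -sub1_expr_folded ?pn //.
    have -> : z i ^+ 2 + del ^+ 2 * z j ^+ 2 =
        z i ^+ 2 * (1 - (z i ^+ 2)^-1 * - (del * z j) ^+ 2) by field; apply: z0.
    by rewrite (exprMn (p - 4)) -!exprM mulrCA [(2 * _)%N]mulnC.
  have -> : (z i ^+ 2)^-1 * - (del * z j) ^+ 2 =
      -1 * (del * z j / z i) ^+ 2 by field; apply: z0.
  rewrite exprMn -exprM mul2n -[n.*2]/((n.*2.+1).-1) pn expf_pred_p ?mulr1 //.
  by rewrite !mulf_neq0 ?invr_eq0.
(* Since [j^2 - i^2 = i^2 j^2 (i^-2 - j^-2)], the difference [w_j - w_i] is a
   nonzero square times [u_j - u_i]. *)
have detw : \det (Vandermonde n w) =
    (\prod_(i < n) \prod_(j < n | (i < j)%N) (del * z i * z j)) ^+ 2 *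
    \det (Vandermonde n u).
  rewrite !det_Vandermonde -prodrXl -big_split /=; apply: eq_bigr => i _.
  rewrite -prodrXl -big_split /=; apply: eq_bigr => j _.
  by rewrite !mxE; field; rewrite !z0.
have detu0 : \det (Vandermonde n u) != 0.
  rewrite det_Vandermonde; apply/prodf_neq0 => i _; apply/prodf_neq0 => j lt_ij.
  rewrite !mxE subr_eq0 (inj_eq invr_inj) -subr_eq0 subr_sqr.
  have lt_jn := ltn_ord j; rewrite mulf_neq0 // -!zE.
    by rewrite -natrB ?small_neq0 //; lia.
  by rewrite -natrD small_neq0 //; lia.
have [K K0 KE] := folded_scale_sqr _ _ chF p_gt4 n.
exists (\prod_i z i ^+ (p - 4) *
        (\prod_(i < n) \prod_(j < n | (i < j)%N) (del * z i * z j)) *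
        \det (Vandermonde n u) / K).
  rewrite !mulf_neq0 ?invr_eq0 //.
    by apply/prodf_neq0 => i _; rewrite expf_neq0.
  by apply/prodf_neq0 => i _; apply/prodf_neq0 => j _; rewrite !mulf_neq0.
apply: (mulfI (expf_neq0 2 K0)); rewrite -{1}KE.
rewrite /Sdet -det_map_mx -detZ scaled det_mulmx det_diag det_sum_pow detw.
under eq_bigr do rewrite mxE.
by rewrite prodrXl; field.
Qed.

(** * The product of the coefficients up to squares *)

(** Pairing [s] with its mirror image, with [c] terms left in the middle. *)
Lemma prod_mirror (R : comPzRingType) (c m : nat) (f : nat -> R) :
  \prod_(s < m.*2 + c) f s =
    \prod_(s < c) f (m + s)%N * \prod_(s < m) (f s * f ((m.*2 + c).-1 - s)%N).
Proof.
elim: m f => [|m IHm] f; first by rewrite big_ord0 mulr1; apply: eq_bigr.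
rewrite doubleS 2!addSn big_ord_recl big_ord_recr /= (IHm (f \o succn)) /=.
rewrite [in RHS]big_ord_recl /= subn0.
have -> : \prod_(s < m) (f (bump 0 s) * f ((m.*2 + c).+1 - bump 0 s)%N) =
    \prod_(s < m) (f s.+1 * f ((m.*2 + c).-1 - s).+1).
  by apply: eq_bigr => s _; congr (f _ * f _);
    rewrite /bump; have := ltn_ord s; lia.
by rewrite /bump /= !add1n; ring.
Qed.

Lemma folded_coefN (F : fieldType) (n : nat) (v : F) :
  folded_coef n (- v) = (-1) ^+ n.+1 * folded_coef n v.
Proof. by rewrite /folded_coef -signr_odd /=; case: (odd n) => /=; ring. Qed.

(** Mirror images give opposite values of [4s + 7], as these integers sum to
    [2 (4m + 2c + 5)], so the two factors agree up to sign. *)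
Lemma prod_folded_coef_mirror (F : fieldType) (m c : nat) :
  (4 * m + 2 * c + 5)%:R = 0 :> F ->
  \prod_(s < m.*2 + c) folded_coef (m.*2 + c).+2 (4 * s%:R + 7) =
    \prod_(s < c) folded_coef (m.*2 + c).+2 (4 * (m + s)%:R + 7) *
    ((-1) ^+ (m * c.+1)
       * (\prod_(s < m) folded_coef (m.*2 + c).+2 (4 * s%:R + 7)) ^+ 2) :> F.
Proof.
move=> p0.
rewrite (prod_mirror _ _ _ (fun s => folded_coef (m.*2 + c).+2 (4 * s%:R + 7))).
congr (_ * _); rewrite mulnC exprM -prodrXl.
rewrite -[m in X in X * _](card_ord m) -prodr_const -big_split.
apply: eq_bigr => s _ /=; have lt_sm := ltn_ord s.
have -> : 4 * ((m.*2 + c).-1 - s)%:R + 7 = - (4 * s%:R + 7) :> F.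
  apply/eqP; rewrite -addr_eq0 -[4]/(4%:R) -[7]/(7%:R) -!natrM -!natrD.
  rewrite (_ : _ + _ = 2 * (4 * m + 2 * c + 5))%N; last by lia.
  by rewrite natrM p0 mulr0.
rewrite folded_coefN -signr_odd /= !oddD odd_double.
by rewrite -[in RHS]signr_odd /= negbK; ring.
Qed.

(** At the two indices without mirror image, [4s + 7] is [-3] and [1]. *)
Lemma last_folded_coefs (F : fieldType) (n : nat) :
  n.+2.*2.+1%:R = 0 :> F ->
  folded_coef n.+2 (4 * n%:R + 7) * folded_coef n.+2 (4 * n.+1%:R + 7) =
    (if odd n then - 16 else - 144) :> F.
Proof.
move=> p0; have n2 : n%:R *+ 2 = - 5 :> F.
  apply/eqP; rewrite -addr_eq0 -mulrnA -natrD; apply/eqP; rewrite -[RHS]p0.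
  by congr (_%:R); lia.
have -> : 4 * n%:R + 7 = - 3 :> F.
  by transitivity (n%:R *+ 2 *+ 2 + 7 : F); [ring | rewrite n2; ring].
have -> : 4 * n.+1%:R + 7 = 1 :> F.
  transitivity (n%:R *+ 2 *+ 2 + 11 : F); first by rewrite -natr1; ring.
  by rewrite n2; ring.
by rewrite /folded_coef /= negbK; case: (odd n); ring.
Qed.

(** The unpaired factors are [-5] at the midpoint and [-16] at the end, and
    [-5 * -16 = 5 * 4^2]. *)
Lemma prod_folded_coef_odd (F : fieldType) (m : nat) :
  m.*2.+3.*2.+1%:R = 0 :> F ->
  \prod_(s < m.*2.+3) folded_coef m.*2.+3 (4 * s%:R + 7) =
    5 * (4 * \prod_(s < m) folded_coef m.*2.+3 (4 * s%:R + 7)) ^+ 2 :> F.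
Proof.
move=> p0; have p0' : (4 * m + 2 * 1 + 5)%:R = 0 :> F.
  by rewrite -[RHS]p0; congr (_%:R); lia.
rewrite 2!big_ord_recr /= -mulrA last_folded_coefs // /= odd_double /=.
rewrite -[m.*2.+1]addn1 (prod_folded_coef_mirror _ m 1) // big_ord1 /= addn0.
have -> : 4 * m%:R + 7 = 0 :> F.
  by rewrite -[RHS]p0'; rewrite !natrD natrM; ring.
by rewrite exprM sqrr_sign addn1 /folded_coef /= negbK odd_double /=; ring.
Qed.

(** Each of the [m] pairs contributes a sign, and the last two factors
    contribute [-144 = - 12^2]. *)
Lemma prod_folded_coef_even (F : fieldType) (m : nat) :
  m.*2.+2.*2.+1%:R = 0 :> F ->
  \prod_(s < m.*2.+2) folded_coef m.*2.+2 (4 * s%:R + 7) =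
    (-1) ^+ m.+1
      * (12 * \prod_(s < m) folded_coef m.*2.+2 (4 * s%:R + 7)) ^+ 2 :> F.
Proof.
move=> p0; have p0' : (4 * m + 2 * 0 + 5)%:R = 0 :> F.
  by rewrite -[RHS]p0; congr (_%:R); lia.
rewrite 2!big_ord_recr /= -mulrA last_folded_coefs // odd_double /=.
rewrite -[m.*2]addn0 (prod_folded_coef_mirror _ m 0) // big_ord0.
rewrite mul1r muln1 addn0.
by rewrite [(-1) ^+ m.+1]exprS; ring.
Qed.

Theorem theorem1p5 (p : nat) (p_prime : prime p) (p_gt4 : (4 < p)%N)
    (d : int) (d_res : legendre d p = 1) :
  legendre (Sdet (p - 4)%N d p) p = -1 <->
  (p = 3 %[mod 20])%N \/ (p = 7 %[mod 20])%N.
Proof.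
have [del del0 d_sqr] := legendre_eq1 _ p_prime _ d_res.
have chF := pchar_Fp p_prime.
have [g g0] := Sdet_Fp _ p_prime p_gt4 _ _ del0 d_sqr.
rewrite legendre_eqN1 // => ->.
have odd_p : odd p by case: (even_prime p_prime) p_gt4 => [-> |].
have p0 : p%:R = 0 :> 'F_p by rewrite (pcharf0 chF).
have [p1 | p3] : (p = 1 %[mod 4])%N \/ (p = 3 %[mod 4])%N by lia.
  have [m nE] : exists m, (p.-1)./2 = m.*2.+2.
    by exists ((p.-1)./2 - 2)./2; lia.
  rewrite nE prod_folded_coef_even; last by rewrite -[RHS]p0; congr (_%:R); lia.
  set Q := \prod_(s < m) _.
  have [i i2] := sqr_opp1_Fp _ p_prime p1.
  split; last by lia.
  case; exists (g * (i ^+ m.+1 * (12 * Q))).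
  by rewrite [RHS]exprMn [in RHS](exprMn 2 (i ^+ _)) exprAC i2.
have [m nE] : exists m, (p.-1)./2 = m.*2.+3.
  by exists ((p.-1)./2 - 2)./2; lia.
rewrite nE prod_folded_coef_odd; last by rewrite -[RHS]p0; congr (_%:R); lia.
set Q := \prod_(s < m) _; have p_gt5 : (5 < p)%N by lia.
rewrite mulrCA -exprMn; set e := g * (4 * Q).
suff -> : (exists y, 5 * e ^+ 2 = y ^+ 2) <-> (exists y : 'F_p, 5 = y ^+ 2).
  have p5 : (p %% 5 != 0)%N.
    rewrite -/(5 %| p)%N -prime_coprime // coprime_sym prime_coprime //.
    by rewrite gtnNdvd.
  by rewrite (sqr_5_Fp _ p_prime p_gt5 p3); split; lia.
split=> [[y y2] | [w ->]]; last by exists (w * e); rewrite -exprMn.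
(* If the square vanishes, so does some [v^2 - 5], and [v] is a root of [5]. *)
have [e0 | e0] := eqVneq e 0; last first.
  by exists (y / e); rewrite expr_div_n -y2 mulfK ?expf_neq0.
have four0 : 4 != 0 :> 'F_p by rewrite -(dvdn_pcharf chF) gtnNdvd.
move/eqP: e0; rewrite !mulf_eq0 (negbTE g0) (negbTE four0) /=.
move/prodf_eq0 => [s _].
rewrite /folded_coef /= negbK odd_double subr_eq0 => /eqP <-.
by exists (4 * s%:R + 7).
Qed.
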